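(* Let $m\neq 0$ and $a$ be real numbers. For every integer $n\ge 0$ and every real $x$ with $m+x\neq 0$, the noncentral Tanny-Dowling polynomials satisfy the explicit formula $$\widetilde{\mathcal F}_{m,a}(n;x)=x\sum_{k=0}^n(-1)^{n+k}\,k!\,\widetilde W_{m,-a}(n,k)\,(m+x)^{k-1}+\frac{(-a)^n m}{m+x},$$ where $\widetilde W_{m,-a}(n,k)$ are the noncentral Whitney numbers of the second kind.
   Context: For real $m\ne0$ and real $a$, the noncentral Whitney numbers of the second kind $\widetilde W_{m,a}(n,k)$ ($0\le k\le n$) are given by $\sum_{n\ge k}\widetilde W_{m,a}(n,k)\frac{z^n}{n!}=\frac{e^{-az}}{k!}\left(\frac{e^{mz}-1}{m}\right)^k$. The noncentral Tanny-Dowling polynomials are $\widetilde{\mathcal F}_{m,a}(n;x)=\sum_{k=0}^n k!\,\widetilde W_{m,a}(n,k)x^k$; equivalently, as formal power series in $z$, $\sum_{n\ge0}\widetilde{\mathcal F}_{m,a}(n;x)\frac{z^n}{n!}=\frac{me^{-az}}{m-x(e^{mz}-1)}$. Convention: $0^0=1$. *)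

(* Defs.v *)
From mathcomp Require Import all_boot all_order all_algebra.
From mathcomp Require Import all_classical all_reals all_analysis.

Set Implicit Arguments.
Unset Strict Implicit.
Unset Printing Implicit Defensive.

Import Order.TTheory GRing.Theory Num.Theory.
Local Open Scope ring_scope.

(* A formal power series \sum_n f n z^n is its coefficient sequence f : R^nat.
   In particular the library's [exp_coeff c], n |-> c ^+ n / n`!%:R, is the
   formal series e^(cz). *)
Section FormalPowerSeries.
Variable R : realType.

Definition fps_one : R^nat := fun n => (n == 0%N)%:R.

Definition fps_mul (f g : R^nat) : R^nat :=
  fun n => \sum_(i < n.+1) f i * g (n - i)%N.

Definition fps_pow (f : R^nat) (k : nat) : R^nat := iter k (fps_mul f) fps_one.

End FormalPowerSeries.

Section NoncentralWhitney.
Variable R : realType.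

(* e^(-az) / k! * ((e^(mz) - 1) / m)^k *)
Definition ncwhitney2_egf (m a : R) (k : nat) : R^nat := fun n =>
  (k`!%:R)^-1 *
  fps_mul (exp_coeff (- a))
    (fps_pow (fun i => (exp_coeff m i - fps_one R i) / m) k) n.

(* The number whose quotient by n! is the coefficient of z^n above. That
   series has order at least k, so the value is 0 for n < k. *)
Definition ncwhitney2 (m a : R) (n k : nat) : R :=
  n`!%:R * ncwhitney2_egf m a k n.

Definition nctanny_dowling (m a : R) (n : nat) : {poly R} :=
  \sum_(k < n.+1) (k`!%:R * ncwhitney2 m a n k) *: 'X^k.

End NoncentralWhitney.

(* Main.v *)
Require Import Defs.
From mathcomp Require Import all_boot all_order all_algebra.
From mathcomp Require Import all_classical all_reals all_analysis.
From mathcomp Require Import ring.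

Import Order.TTheory GRing.Theory Num.Theory.
Local Open Scope ring_scope.

(** Put U = (e^(mz) - 1) / m and U' = (e^(-mz) - 1) / (-m), so that the
    generating function of the polynomials F_(m,a)(n; x) is e^(-az) / (1 - xU).
    Two facts carry the formula.

    Replacing z by -z in the generating function of the Whitney numbers gives
    (-1)^(n+k) W_(m,-a)(n,k) = W_(-m,a)(n,k) ([ncwhitney2_reflect]).  The sum on
    the right-hand side is therefore F_(-m,a)(n; m+x) / (m+x), and the
    polynomials F_(-m,a)(n; m+x) have the generating function
    e^(-az) / (1 - (m+x)U').

    Next, e^(mz) e^(-mz) = 1 reads U - U' = m U U', that is 1 + mU is the
    inverse of 1 - mU', and this is all that is needed for
      (m+x) / (1 - xU) = x / (1 - (m+x)U') + m.
    Multiplying by e^(-az) and comparing the coefficients of z^n / n! gives the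
    theorem.

    Coefficients of order at most n are all that matters, so the calculation
    takes place among polynomials modulo X^(n+1): a series f becomes its
    truncation, and 1 / (1 - xU) becomes the finite geometric sum of the (xU)^k,
    which is an inverse modulo X^(n+1) because U has no constant term
    ([dvdXn_geometric]).  The displayed equality then holds modulo X^(n+1)
    ([dvdp_geometric_shift]). *)

Section Truncation.
Local Set Implicit Arguments.
Local Unset Strict Implicit.
Variable R : realType.
Implicit Types (p q : {poly R}) (f g : R^nat).

Lemma dvdXnP N p :
  reflect (forall i, (i < N)%N -> p`_i = 0) (('X^N : {poly R}) %| p).
Proof.
apply: (iffP idP) => [/dvdpP[q ->] i iN|p0]; first by rewrite coefMXn iN.
rewrite -(poly_take_drop N p) (_ : take_poly N p = 0) ?add0r ?dvdp_mull//.
by apply/polyP => i; rewrite coef_take_poly coef0; case: ifP => // /p0.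
Qed.

Definition trunc N f : {poly R} := \poly_(i < N) f i.

Lemma coef_trunc_mul N f g p q i : (i < N)%N ->
  (forall j, (j < N)%N -> p`_j = f j) -> (forall j, (j < N)%N -> q`_j = g j) ->
  (p * q)`_i = fps_mul f g i.
Proof.
move=> iN pf qg; rewrite coefM; apply: eq_bigr => j _.
rewrite pf ?qg//; first exact: leq_ltn_trans (leq_subr _ _) iN.
exact: leq_trans (ltn_ord j) iN.
Qed.

Lemma coef_trunc N f i : (i < N)%N -> (trunc N f)`_i = f i.
Proof. by move=> iN; rewrite coef_poly iN. Qed.

Lemma coef_trunc_pow N f k i : (i < N)%N ->
  (trunc N f ^+ k)`_i = fps_pow f k i.
Proof.
elim: k i => [|k IHk] i iN; first by rewrite expr0 coef1.
by rewrite exprS (coef_trunc_mul iN (@coef_trunc N f) IHk).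
Qed.

(** The product telescopes to 1 - p^N, and X divides p. *)
Lemma dvdXn_geometric N p : p`_0 = 0 ->
  ('X^N : {poly R}) %| (1 - p) * (\sum_(k < N) p ^+ k) - 1.
Proof.
move=> p0; rewrite -(opprB p 1) mulNr -subrX1 opprB addrAC subrr add0r dvdpNr.
by apply: dvdp_exp2r; rewrite -['X]subr0 dvdp_XsubCl rootE horner_coef0 p0.
Qed.

End Truncation.

Section ExponentialSeries.
Local Set Implicit Arguments.
Local Unset Strict Implicit.
Variable R : realType.
Implicit Types (a b c : R) (f g : R^nat).

Lemma fps_mul_exp_coeff a b n :
  fps_mul (exp_coeff a) (exp_coeff b) n = exp_coeff (a + b) n.
Proof.
rewrite /fps_mul /exp_coeff /= addrC exprDn mulr_suml.
apply: eq_bigr => -[i /=]; rewrite ltnS => ile _.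
have fact0 k : k`!%:R != 0 :> R by rewrite pnatr_eq0 -lt0n fact_gt0.
have /(congr1 (fun k => k%:R : R)) := bin_fact ile; rewrite !natrM => <-.
rewrite -mulr_natr; field.
by rewrite !fact0 pnatr_eq0 -lt0n bin_gt0 ile.
Qed.

Lemma exp_coeff0r n : exp_coeff (0 : R) n = fps_one R n.
Proof.
rewrite /exp_coeff /fps_one /= expr0n.
by case: n => [|n] /=; rewrite ?mul0r// fact0 divr1.
Qed.

Lemma exp_coeffN c n : exp_coeff (- c) n = (-1) ^+ n * exp_coeff c n.
Proof. by rewrite /exp_coeff /= (exprNn c) mulrA. Qed.

(** The substitution z |-> -z is multiplicative on series; the scalars s and t
    absorb the signs that the factors may carry. *)
Lemma fps_mul_reflect (s t : R) f f' g g' n :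
  (forall i, f' i = s * (-1) ^+ i * f i) ->
  (forall i, g' i = t * (-1) ^+ i * g i) ->
  fps_mul f' g' n = s * t * (-1) ^+ n * fps_mul f g n.
Proof.
move=> f'E g'E; rewrite /fps_mul mulr_sumr; apply: eq_bigr => -[i /=].
rewrite ltnS => ile _; rewrite f'E g'E.
have -> : (-1) ^+ n = (-1) ^+ i * (-1) ^+ (n - i) :> R.
  by rewrite -exprD subnKC.
ring.
Qed.

End ExponentialSeries.

Section NoncentralTannyDowling.
Variable R : realType.
Implicit Types (m a x : R).

Definition scaled_expm1 m : R^nat :=
  fun i => (exp_coeff m i - fps_one R i) / m.

(** The change of variable z |-> -z turns (e^(mz) - 1) / m into the opposite of
    (e^(-mz) - 1) / (-m), hence a sign (-1)^k from the k-th power besides the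
    sign (-1)^n of the coefficient of z^n. *)
Lemma ncwhitney2_reflect m a n k :
  ncwhitney2 (- m) a n k = (-1) ^+ (n + k) * ncwhitney2 m (- a) n k.
Proof.
have baseE i : scaled_expm1 (- m) i = -1 * (-1) ^+ i * scaled_expm1 m i.
  rewrite /scaled_expm1 exp_coeffN invrN.
  have {1}-> : fps_one R i = (-1) ^+ i * fps_one R i.
    by rewrite /fps_one; case: i => [|i]; rewrite /= ?mulr0// expr0 mul1r.
  ring.
have powE j : fps_pow (scaled_expm1 (- m)) k j
    = (-1) ^+ k * (-1) ^+ j * fps_pow (scaled_expm1 m) k j.
  elim: k j => [|k IHk] j.
    by rewrite /fps_pow /fps_one /=; case: j => [|j]; rewrite /= ?mulr0// !mulr1.
  by rewrite /= (fps_mul_reflect _ baseE IHk) exprS.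
have expE i : exp_coeff (- a) i = 1 * (-1) ^+ i * exp_coeff (- - a) i.
  by rewrite mul1r opprK exp_coeffN.
rewrite /ncwhitney2 /ncwhitney2_egf (fps_mul_reflect _ expE powE) exprD.
rewrite -/(scaled_expm1 m); ring.
Qed.

(** This is the generating function e^(-az) / (1 - xU), with the geometric sum
    cut after the term of degree n in U, beyond which U^k has no z^n. *)
Lemma horner_nctanny_dowling m a n x :
  (nctanny_dowling m a n).[x] =
  n`!%:R * (trunc n.+1 (exp_coeff (- a))
            * \sum_(k < n.+1) (x%:P * trunc n.+1 (scaled_expm1 m)) ^+ k)`_n.
Proof.
rewrite /nctanny_dowling horner_sum mulr_sumr coef_sum mulr_sumr.
apply: eq_bigr => k _; rewrite hornerZ hornerXn exprMn -rmorphXn /=.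
rewrite [trunc _ _ * _]mulrCA coefCM (coef_trunc_mul (ltnSn n) (@coef_trunc _ _ _)
  (fun j => @coef_trunc_pow _ n.+1 _ k j)).
rewrite /ncwhitney2 /ncwhitney2_egf -/(scaled_expm1 m).
have k0 : k`!%:R != 0 :> R by rewrite pnatr_eq0 -lt0n fact_gt0.
by field.
Qed.

Lemma polyC_mul_scaled_expm1 N m : m != 0 ->
  m%:P * trunc N.+1 (scaled_expm1 m) = trunc N.+1 (exp_coeff m) - 1.
Proof.
move=> m0; apply/polyP => j; rewrite coefCM coefB coef1 !coef_poly.
case: ltnP => [_|jN]; first by rewrite mulrC divfK.
by rewrite mulr0 sub0r gtn_eqF ?oppr0// (leq_trans _ jN).
Qed.

(** This is m U U' = U - U', the identity e^(mz) e^(-mz) = 1 divided by m. *)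
Lemma dvdXn_scaled_expm1 N m (U := trunc N.+1 (scaled_expm1 m))
    (U' := trunc N.+1 (scaled_expm1 (- m))) : m != 0 ->
  ('X^(N.+1) : {poly R}) %| U - U' - m%:P * (U * U').
Proof.
move=> m0; rewrite -(dvdpZr _ _ m0) -mul_polyC.
pose E (c : R) := trunc N.+1 (exp_coeff c).
have mU : m%:P * U = E m - 1 by exact: polyC_mul_scaled_expm1.
have mU' : m%:P * U' = 1 - E (- m).
  by rewrite -opprB -polyC_mul_scaled_expm1 ?oppr_eq0// polyCN mulNr opprK.
have -> : m%:P * (U - U' - m%:P * (U * U')) = E m * E (- m) - 1.
  rewrite (_ : E m = m%:P * U + 1); last by rewrite mU subrK.
  by rewrite (_ : E (- m) = 1 - m%:P * U'); [ring | rewrite mU'; ring].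
apply/dvdXnP => i iN.
rewrite coefB (coef_trunc_mul iN (@coef_trunc _ _ _) (@coef_trunc _ _ _)).
by rewrite fps_mul_exp_coeff subrr exp_coeff0r coef1 subrr.
Qed.

(** With G = 1 / (1 - xU) and G' = 1 / (1 - (m+x)U') modulo d, the first
    hypothesis says that 1 - (m+x)U' = (1 - xU) / (1 + mU), so that
    G' = (1 + mU) G; the conclusion becomes m+x = x (1 + mU) + m (1 - xU) after division by G. *)
Lemma dvdp_geometric_shift (d m x U U' G G' : {poly R}) :
  d %| U - U' - m * (U * U') ->
  d %| (1 - x * U) * G - 1 ->
  d %| (1 - (m + x) * U') * G' - 1 ->
  d %| (m + x) * G - x * G' - m.
Proof.
set e := _ - _ - _; set eG := _ - 1; set eG' := _ - 1 => de deG deG'.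
(* (1 - x * U) times the polynomial to be divided is a combination of e, eG and
   eG'; multiplying it by G restores that polynomial up to a multiple of eG. *)
suff -> : (m + x) * G - x * G' - m =
    G * ((m + x) * eG - x * (1 + m * U) * eG' + x * (m + x) * G' * e)
    - eG * ((m + x) * G - x * G' - m).
  apply: dvdp_sub; last exact: dvdp_mulr.
  by apply/dvdp_mull/dvdp_add; [apply: dvdp_sub|]; exact: dvdp_mull.
rewrite /e /eG /eG'; ring.
Qed.

(** The formula before the reflection of the Whitney numbers: it compares the
    polynomials of parameters m and -m at x and m+x. *)
Lemma nctanny_dowling_shift m a n x : m != 0 ->
  (m + x) * (nctanny_dowling m a n).[x] =
  x * (nctanny_dowling (- m) a n).[m + x] + m * (- a) ^+ n.
Proof.
move=> m0; rewrite !horner_nctanny_dowling.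
set E := trunc _ (exp_coeff _).
set U := trunc _ (scaled_expm1 m); set U' := trunc _ (scaled_expm1 (- m)).
set G := \sum_(k < _) (x%:P * U) ^+ k; set G' := \sum_(k < _) _.
have U0 c y : (y%:P * trunc n.+1 (scaled_expm1 c))`_0 = 0.
  rewrite coefCM coef_trunc// /scaled_expm1 /exp_coeff /fps_one /=.
  by rewrite expr0 divr1 subrr mul0r mulr0.
have : ('X^(n.+1) : {poly R}) %| (m%:P + x%:P) * G - x%:P * G' - m%:P.
  apply: (@dvdp_geometric_shift _ _ _ U U'); first exact: dvdXn_scaled_expm1.
    exact/dvdXn_geometric/U0.
  by rewrite -polyCD; exact/dvdXn_geometric/U0.
move=> /(dvdp_mull E) /dvdXnP /(_ n (ltnSn n)).
rewrite -polyCD !mulrBr !coefB (mulrC E m%:P) coefCM.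
rewrite ![E * (_%:P * _)]mulrCA !coefCM coef_trunc// => /eqP.
rewrite subr_eq0 subr_eq => /eqP coefE.
rewrite mulrCA coefE mulrDr /exp_coeff /=.
have n0 : n`!%:R != 0 :> R by rewrite pnatr_eq0 -lt0n fact_gt0.
by field.
Qed.

End NoncentralTannyDowling.

Theorem theorem5 (R : realType) (m a : R) (hm : m != 0)
    (n : nat) (x : R) (hmx : m + x != 0) :
  (nctanny_dowling m a n).[x] =
    x * (\sum_(k < n.+1)
           (-1) ^+ (n + k) * k`!%:R * ncwhitney2 m (- a) n k
             * (m + x) ^ (k%:Z - 1))
    + (- a) ^+ n * m / (m + x).
Proof.
have -> : \sum_(k < n.+1) (-1) ^+ (n + k) * k`!%:R * ncwhitney2 m (- a) n k
      * (m + x) ^ (k%:Z - 1) = (nctanny_dowling (- m) a n).[m + x] / (m + x).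
  rewrite horner_sum mulr_suml; apply: eq_bigr => k _.
  rewrite hornerZ hornerXn ncwhitney2_reflect expfzDr// exprN1 -exprnP; ring.
apply: (mulfI hmx); rewrite nctanny_dowling_shift//; field.
by [].
Qed.
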